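(* For every $n\ge 1$ the augmentation, i.e. the restriction map $$\mathrm{Res}:H^*_G(B_GU(n))\to H^*(BU(n)),$$ is a split surjection, so the nonequivariant Chern classes $c_1,\dots,c_n$ have $C_2$-equivariant refinements in $H^*_G(B_GU(n))$ (elements restricting to them).
   Context: $G=C_2$. $A_{\mathbb{Q}}$ is the rational Burnside Green functor: $A_{\mathbb{Q}}(G/G)=\mathbb{Q}[x]/(x^2-2x)$ with $x=\mathrm{Tr}(1)$, $A_{\mathbb{Q}}(G/e)=\mathbb{Q}$, restriction $x\mapsto 2$; $y=1-x/2$. For a $G$-space $X$, $H^*_G(X)$ is the integer-graded unreduced Bredon cohomology $H^*_G(X)(G/H)=[X_+,\Sigma^*HA_{\mathbb{Q}}]^H$; the notation also denotes its top level $H^*_G(X)(G/G)$, a graded algebra over $A_{\mathbb{Q}}(G/G)$ (also written $A_{\mathbb{Q}}$). $H^*(-)$ is ordinary cohomology with $\mathbb{Q}$-coefficients; $H^*_G(X)(G/e)=H^*(X)$. By Greenlees–May there is a natural ring isomorphism $H^*_G(X)(G/G)\cong H^*(X)^{C_2}\times H^*(X^{C_2})$ under which $x=(2,0)$, $y=(0,1)$ and restriction to the $G/e$ level is the projection to the first factor. $B_GU(n)$ is the classifying space of $C_2$-equivariant complex $n$-plane bundles, modelled by the Grassmannian of complex $n$-dimensional subspaces of $\mathbb{C}^{\infty\rho}$, $\rho=1+\sigma$ the complex regular representation; its underlying space is $BU(n)$. $H^*_G(B_GU(n))$ is viewed as an augmented algebra over $H^*(BU(n))$ with augmentation given by restriction.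 *)

(* Defs.v *)
From HB Require Import structures.
From mathcomp Require Import all_boot all_order all_algebra.
From mathcomp Require Import all_classical all_reals all_analysis.
From mathcomp Require Import complex.

Set Implicit Arguments.
Unset Strict Implicit.
Unset Printing Implicit Defensive.

Import Order.TTheory GRing.Theory Num.Theory.
Import numFieldNormedType.Exports.

Local Open Scope classical_set_scope.
Local Open Scope ring_scope.
Local Open Scope quotient_scope.

Section Cohomology.
Variables (K : pzRingType) (C : nat -> lmodType K).
Variable d : forall p, {linear C p -> C p.+1}.

Definition cocycle_pred p : {pred C p} := fun z => d p z == 0.

Fact cocycle_closed p : submod_closed (@cocycle_pred p).
Proof.
split; first by rewrite unfold_in linear0.
by move=> a u v /eqP du /eqP dv; rewrite unfold_in linearP du dv scaler0 addr0.
Qed.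
HB.instance Definition _ p :=
  GRing.isSubmodClosed.Build K (C p) (@cocycle_pred p) (@cocycle_closed p).

Record cocycle p := Cocycle { cocycle_val :> C p; _ : cocycle_val \in @cocycle_pred p }.
HB.instance Definition _ p := [isSub for @cocycle_val p].
HB.instance Definition _ p := [Choice of cocycle p by <:].
HB.instance Definition _ p := [SubChoice_isSubLmodule of cocycle p by <:].

Definition is_coboundary p : C p -> Prop :=
  match p with
  | 0 => fun z => z = 0
  | q.+1 => fun z => exists y : C q, d q y = z
  end.

Definition coboundary_pred p : {pred cocycle p} := fun z => `[< is_coboundary (val z) >].

Fact coboundary_closed p : submod_closed (@coboundary_pred p).
Proof.
split; first by apply/asboolP; case: p => [//|q]; exists 0; rewrite linear0.
case: p => [|q] a u v /asboolP + /asboolP + ; rewrite /coboundary_pred unfold_in.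
  by move=> /= u0 v0; apply/asboolP; rewrite /= u0 v0 scaler0 addr0.
by move=> /= [x ux] [y vy]; apply/asboolP; exists (a *: x + y); rewrite linearP ux vy.
Qed.
HB.instance Definition _ p :=
  GRing.isSubmodClosed.Build K (cocycle p) (@coboundary_pred p) (@coboundary_closed p).

Definition cohomology p := Quotient.quot (@coboundary_pred p).
HB.instance Definition _ p := Quotient.on (cohomology p).
HB.instance Definition _ p := GRing.Zmodule.on (cohomology p).
HB.instance Definition _ p := ZmodQuotient.on (cohomology p).

Definition cohomology_scale p (a : K) (u : cohomology p) : cohomology p :=
  \pi_(cohomology p) (a *: repr u).

Fact pi_scale p a (z : cocycle p) :
  cohomology_scale a (\pi_(cohomology p) z) = \pi_(cohomology p) (a *: z).
Proof.
apply/eqP; rewrite -Quotient.idealrBE -scalerBr rpredZ //.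
by rewrite Quotient.idealrBE reprK.
Qed.

Fact cohomology_scaleA p a b (u : cohomology p) :
  cohomology_scale a (cohomology_scale b u) = cohomology_scale (a * b) u.
Proof. by elim/quotW: u => u; rewrite (pi_scale b) !pi_scale scalerA. Qed.

Fact cohomology_scale1 p : left_id 1 (@cohomology_scale p).
Proof. by elim/quotW=> u; rewrite pi_scale scale1r. Qed.

Fact cohomology_scaleDr p : right_distributive (@cohomology_scale p) +%R.
Proof.
move=> a; elim/quotW=> u; elim/quotW=> v.
by rewrite -raddfD !pi_scale scalerDr raddfD.
Qed.

Fact cohomology_scaleDl p (u : cohomology p) :
  {morph (@cohomology_scale p)^~ u : a b / a + b}.
Proof.
by move=> a b; elim/quotW: u => u; rewrite !pi_scale scalerDl raddfD.
Qed.

HB.instance Definition _ p := GRing.Zmodule_isLmodule.Build K (cohomology p)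
  (@cohomology_scaleA p) (@cohomology_scale1 p) (@cohomology_scaleDr p)
  (@cohomology_scaleDl p).

(* Total on cochains (0 if z is not a cocycle), so that operations on cohomology
   can be given by cochain formulas on representatives; all those used below send
   cocycles to cocycles. *)
Definition class p (z : C p) : cohomology p := \pi_(cohomology p) (insubd (0 : cocycle p) z).

Definition rep p (u : cohomology p) : C p := val (repr u).

End Cohomology.

Fact continuous_mx (T U : topologicalType) m n (f : T -> 'M[U]_(m, n)) :
  (forall i j, continuous (fun t => f t i j)) -> continuous f.
Proof.
move=> fc t A [P fP PA]; apply: filterS PA _ => //=.
have : \forall s \near t, forall i j, P i j (f s i j).
  by apply: filter_forall => i; apply: filter_forall => j; exact: fc (fP i j).
by [].
Qed.

Fact continuous_to_set_type (T U : topologicalType) (A : set U) (f : T -> set_type A) :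
  continuous (fun t => val (f t)) -> continuous f.
Proof. exact: continuous_comp_initial. Qed.

Fact continuous_coord_val (K : numFieldType) m n (A : set 'M[K]_(m, n)) i j :
  continuous (fun M : set_type A => val M i j).
Proof.
move=> M; apply: (@cvg_comp _ _ _ (fun M : set_type A => val M) (fun M => M i j)).
  exact: initial_continuous.
exact: coord_continuous.
Qed.

Fact continuous_mulr (T : topologicalType) (K : numFieldType) (f : T -> K) (c : K) :
  continuous f -> continuous (fun t => f t * c).
Proof. by move=> fc t; apply: cvgM; [exact: fc | exact: cvg_cst]. Qed.

Fact continuous_sum (T : topologicalType) (K : numFieldType) I (r : seq I)
    (P : pred I) (f : I -> T -> K) :
  (forall i, continuous (f i)) -> continuous (fun t => \sum_(i <- r | P i) f i t).
Proof.
move=> fc; elim: r => [|i r IH].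
  by under [X in continuous X]funext do rewrite big_nil; move=> t; exact: cvg_cst.
under [X in continuous X]funext do rewrite big_cons.
by case: (P i) => // t; apply: cvgD; [exact: fc | exact: IH].
Qed.

Section Singular.
Variable R : realType.

Definition stdsimplex p : set 'rV[R]_p.+1 :=
  [set t | (forall i, 0 <= t 0 i) /\ \sum_i t 0 i = 1].
Definition simplex p := set_type (@stdsimplex p).
HB.instance Definition _ p := Topological.on (simplex p).

(* The affine map of standard simplices that sends vertex i to vertex th i. *)
Section AffineMap.
Variables (p q : nat) (th : 'I_p.+1 -> 'I_q.+1).

Definition affine_row (t : 'rV[R]_p.+1) : 'rV[R]_q.+1 :=
  \row_j \sum_(i | th i == j) t 0 i.

Fact affine_row_simplex (t : simplex p) : affine_row (val t) \in @stdsimplex q.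
Proof.
have [t0 t1] := set_valP t; apply/mem_set; split=> [j|].
  by rewrite mxE sumr_ge0.
by under eq_bigr do rewrite mxE; rewrite -[RHS]t1 [RHS](partition_big th xpredT).
Qed.

Definition affine (t : simplex p) : simplex q :=
  @exist _ (fun x => x \in @stdsimplex q) _ (affine_row_simplex t).

Fact affine_continuous : continuous affine.
Proof.
apply: continuous_to_set_type; apply: continuous_mx => i j /=.
under [X in continuous X]funext do rewrite mxE.
apply: continuous_sum => k; exact: continuous_coord_val.
Qed.
HB.instance Definition _ := isContinuous.Build _ _ affine affine_continuous.
End AffineMap.

Definition sing (X : topologicalType) p := continuousType (simplex p) X.

Definition subsimplex X p q (th : 'I_p.+1 -> 'I_q.+1) (s : sing X q) : sing X p :=
  s \o affine th.

Definition push (X Y : topologicalType) (f : continuousType X Y) p (s : sing X p) :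
  sing Y p := f \o s.

Definition face X p (i : 'I_p.+2) (s : sing X p.+1) : sing X p :=
  subsimplex (lift i) s.
Definition front X p q (s : sing X (p + q)) : sing X p :=
  subsimplex (fun i => inord i) s.
Definition back X p q (s : sing X (p + q)) : sing X q :=
  subsimplex (fun i => inord (p + i)) s.

Definition cochain (M : lmodType rat) (X : topologicalType) (p : nat) :=
  sing X p -> M.
HB.instance Definition _ M X p := GRing.Lmodule.on (cochain M X p).

Definition diff M X p (f : cochain M X p) : cochain M X p.+1 :=
  fun s => \sum_(i < p.+2) (-1) ^+ i *: f (face i s).

Fact diff_linear M X p : linear (@diff M X p).
Proof.
move=> a f g; apply/funext => s; rewrite /diff /=.
rewrite -[RHS]/(a *: diff f s + diff g s) /diff scaler_sumr -big_split.
apply: eq_bigr => i _ /=.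
rewrite -[(a *: f + g) _]/(a *: f (face i s) + g (face i s)).
by rewrite scalerDr !scalerA mulrC.
Qed.
HB.instance Definition _ M X p :=
  GRing.isLinear.Build rat (cochain M X p) (cochain M X p.+1) _ (@diff M X p)
    (@diff_linear M X p).

Definition lin_diff M X p : {linear cochain M X p -> cochain M X p.+1} := @diff M X p.

(* Alexander-Whitney cup product *)
Definition cupc (A : algType rat) X p q (f : cochain A X p) (g : cochain A X q) :
  cochain A X (p + q) := fun s => f (front s) * g (back s).

(* Singular cohomology with rational coefficients *)
Definition HQ (X : topologicalType) p := cohomology (@lin_diff rat^o X) p.
HB.instance Definition _ X p := GRing.Lmodule.on (HQ X p).

Definition HQclass X p (f : cochain rat^o X p) : HQ X p := class (@lin_diff rat^o X) f.

Definition HQone X : HQ X 0 := HQclass (fun=> 1).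

Definition cup X p q (u : HQ X p) (v : HQ X q) : HQ X (p + q) :=
  HQclass (cupc (rep u) (rep v)).

Definition pullback (X Y : topologicalType) (f : continuousType X Y) p (u : HQ Y p) : HQ X p :=
  HQclass (fun s => rep u (push f s)).

End Singular.

(* The rational Burnside Green functor of C_2: its value at G/G is AQ, with x the
   class of 'X; its value at G/e is rat, with trivial Weyl group action; the
   restriction map sends x to 2. *)
Definition burnside_modulus : {poly rat} := 'X^2 - 2%:P * 'X.

Notation AQ := {poly %/ burnside_modulus}.

(* The quotient construction {poly %/ h} replaces h by 'X unless h is monic of
   size at least 2. *)
Fact mk_monic_burnside_modulus : mk_monic burnside_modulus = burnside_modulus.
Proof.
rewrite /mk_monic /burnside_modulus.
have sz : size (2%:P * 'X : {poly rat}) = 2 by rewrite mul_polyC size_scale ?size_polyX.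
rewrite size_polyDl ?size_polyN ?sz ?size_polyXn //= monicE lead_coefDl.
  by rewrite lead_coefXn eqxx.
by rewrite size_polyN sz size_polyXn.
Qed.

Definition burnside_res (a : AQ) : rat := (a : {poly rat}).[2].

Fact burnside_res_linear : linear_for *%R burnside_res.
Proof.
by move=> a u v; rewrite /burnside_res poly_of_qpolyD poly_of_qpolyZ hornerD hornerZ.
Qed.
HB.instance Definition _ :=
  GRing.isLinear.Build rat AQ rat *%R burnside_res burnside_res_linear.

(* A space with an action of C_2, given by the action of the nontrivial element *)
Record C2space := C2Space {
  c2_space :> topologicalType;
  c2_act : continuousType c2_space c2_space;
  c2_actK : involutive c2_act }.

Section Bredon.
Variable R : realType.
Implicit Type X : C2space.

Definition fixed_set X : set X := [set x | c2_act X x = x].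
Definition fixed_space X : topologicalType := set_type (@fixed_set X).
Definition fixed_incl X : fixed_space X -> X := val.
Fact fixed_incl_continuous X : continuous (@fixed_incl X).
Proof. exact: initial_continuous. Qed.
HB.instance Definition _ X := isContinuous.Build _ _ (@fixed_incl X) (@fixed_incl_continuous X).

(* Singular model of integer-graded Bredon cohomology: cochains are the natural
   transformations, over the orbit category of C_2, from the sets of singular
   simplices sing (X^H) p to the coefficients A(G/H). Such a transformation is
   a pair (f.1, f.2) of components at G/e and G/G; naturality for the nontrivial
   automorphism of G/e and for G/e -> G/G gives the two conditions of bredon_pred.
   Differential and cup product are componentwise. *)
Definition pair_cochain X p : lmodType rat :=
  (cochain R rat^o X p * cochain R AQ (fixed_space X) p)%type.

Definition bredon_pred X p : {pred pair_cochain X p} := fun f =>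
  `[< (forall s, f.1 (push (c2_act X) s) = f.1 s) /\
      (forall s, burnside_res (f.2 s) = f.1 (push (@fixed_incl X) s)) >].

Fact bredon_closed X p : submod_closed (@bredon_pred X p).
Proof.
split=> [|a f g /asboolP[f1 f2] /asboolP[g1 g2]]; apply/asboolP; split=> // s /=.
- by rewrite /burnside_res horner0.
- by rewrite -[LHS]/(a *: f.1 _ + g.1 _) f1 g1.
- rewrite -[LHS]/(burnside_res (a *: f.2 s + g.2 s)).
  by rewrite burnside_res_linear; congr (a * _ + _); [exact: f2|exact: g2].
Qed.
HB.instance Definition _ X p :=
  GRing.isSubmodClosed.Build rat (pair_cochain X p) (@bredon_pred X p) (@bredon_closed X p).

Record bredon_cochain X p := BredonCochain {
  bredon_val :> pair_cochain X p; _ : bredon_val \in @bredon_pred X p }.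
HB.instance Definition _ X p := [isSub for @bredon_val X p].
HB.instance Definition _ X p := [Choice of bredon_cochain X p by <:].
HB.instance Definition _ X p := [SubChoice_isSubLmodule of bredon_cochain X p by <:].

Definition pair_diff X p (f : pair_cochain X p) : pair_cochain X p.+1 :=
  (diff f.1, diff f.2).

Fact bredon_diff_proof X p (f : bredon_cochain X p) :
  pair_diff (val f) \in @bredon_pred X p.+1.
Proof.
have /asboolP[f1 f2] := valP f; apply/asboolP; split=> s /=.
  apply: eq_bigr => i _; congr (_ *: _); rewrite -[RHS]f1; congr ((val f).1 _).
  exact/continuousEP.
rewrite /diff linear_sum; apply: eq_bigr => i _.
rewrite linearZ; congr (_ * _); apply: etrans (f2 _) _.
congr ((val f).1 _); exact/continuousEP.
Qed.

Definition bredon_diff X p (f : bredon_cochain X p) : bredon_cochain X p.+1 :=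
  BredonCochain (bredon_diff_proof f).

Fact bredon_diff_linear X p : linear (@bredon_diff X p).
Proof.
by move=> a f g; apply/val_inj; congr pair; exact: diff_linear.
Qed.
HB.instance Definition _ X p := GRing.isLinear.Build rat
  (bredon_cochain X p) (bredon_cochain X p.+1) _ (@bredon_diff X p)
  (@bredon_diff_linear X p).

Definition lin_bredon_diff X p : {linear bredon_cochain X p -> bredon_cochain X p.+1} :=
  @bredon_diff X p.

(* The top level H^p_G(X)(G/G) *)
Definition HG X p := cohomology (@lin_bredon_diff X) p.
HB.instance Definition _ X p := GRing.Lmodule.on (HG X p).

Definition HGclass X p (f : pair_cochain X p) : HG X p :=
  class (@lin_bredon_diff X) (insubd (0 : bredon_cochain X p) f).

Definition HGrep X p (u : HG X p) : pair_cochain X p := val (rep u).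

Definition HGone X : HG X 0 := HGclass (fun=> 1, fun=> 1).

Definition HGcup X p q (u : HG X p) (v : HG X q) : HG X (p + q) :=
  HGclass (cupc (HGrep u).1 (HGrep v).1, cupc (HGrep u).2 (HGrep v).2).

(* The action of A(G/G) *)
Definition HGact X p (a : AQ) (u : HG X p) : HG X p :=
  HGclass (burnside_res a *: (HGrep u).1, fun s => a * (HGrep u).2 s).

(* Restriction to the level H^p_G(X)(G/e) = H^p(X) *)
Definition Res X p (u : HG X p) : HQ R X p := HQclass (HGrep u).1.

End Bredon.

(* C^oo is {poly C}, with the powers of 'X as basis, and C^N is embedded in it by
   rVpoly. With the involution p(X) |-> p(-X) it becomes the representation
   C^{oo rho}: even powers span the trivial summands and odd powers the sign
   summands. Used below for C = R[i]. *)
Section Grassmannian.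
Variable C : numFieldType.

(* Frames of n linearly independent vectors in C^N, as row vectors *)
Definition frame n N := set_type [set A : 'M[C]_(n, N) | row_free A].
HB.instance Definition _ n N := Topological.on (frame n N).

Definition row_span n N (A : 'M[C]_(n, N)) : set {poly C} :=
  [set rVpoly (c *m A) | c in [set: 'rV[C]_n]].

Definition is_plane n (W : set {poly C}) : Prop :=
  exists N (A : 'M[C]_(n, N)), row_free A /\ W = row_span A.

(* n-dimensional subspaces of C^oo *)
Record Gr n := Plane { plane_set :> set {poly C}; planeP : is_plane n plane_set }.

Fact Gr_inj n (V W : Gr n) : plane_set V = plane_set W -> V = W.
Proof.
case: V W => V PV [W PW] /= VW; rewrite VW in PV *.
by congr Plane; exact: Prop_irrelevance.
Qed.

HB.instance Definition _ n := gen_eqMixin (Gr n).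
HB.instance Definition _ n := gen_choiceMixin (Gr n).

Definition frame_span n N (A : frame n N) : Gr n :=
  Plane (ex_intro _ N (ex_intro _ (val A) (conj (set_valP A) erefl))).

(* Colimit over N of the quotient topologies on the Grassmannians of C^N *)
Definition Gr_open n : set_system (Gr n) :=
  [set U | forall N, open (@frame_span n N @^-1` U)].

Fact Gr_openT n : Gr_open [set: Gr n]. Proof. by move=> N; exact: openT. Qed.

Fact Gr_openI n : setI_closed (@Gr_open n).
Proof. by move=> U V oU oV N; exact: openI (oU N) (oV N). Qed.

Fact Gr_open_bigU n (I : Type) (f : I -> set (Gr n)) :
  (forall i, Gr_open (f i)) -> Gr_open (\bigcup_i f i).
Proof. by move=> of_ N; rewrite preimage_bigcup; apply: bigcup_open => i _; exact: of_. Qed.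

HB.instance Definition _ n :=
  isOpenTopological.Build (Gr n) (@Gr_openT n) (@Gr_openI n) (@Gr_open_bigU n).

Fact Gr_openE n (U : set (Gr n)) : open U = Gr_open U.
Proof. by []. Qed.

Fact frame_span_continuous n N : continuous (@frame_span n N).
Proof. by apply/continuousP => U oU; exact: oU. Qed.

Definition sign_poly (p : {poly C}) : {poly C} := p \Po (- 'X).

Fact coef_sign_poly p k : (sign_poly p)`_k = (-1) ^+ k * p`_k.
Proof.
rewrite /sign_poly comp_polyE coef_sum.
under eq_bigr => i _ do rewrite -scaleN1r exprZn scalerA coefZ coefXn.
case: (ltnP k (size p)) => [lt_kp|le_pk].
  rewrite (bigD1 (Ordinal lt_kp)) //= eqxx mulr1 mulrC big1 ?addr0 // => i ik.
  by rewrite (_ : k == i = false) ?mulr0 //; apply: contraNF ik => /eqP ki; apply/eqP/val_inj.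
rewrite big1 ?nth_default ?mulr0 // => i _.
by rewrite (_ : k == i = false) ?mulr0 // gtn_eqF // (leq_trans (ltn_ord i)).
Qed.

Fact sign_polyK : involutive sign_poly.
Proof.
by move=> p; apply/polyP => k; rewrite !coef_sign_poly mulrA -expr2 sqrr_sign mul1r.
Qed.

Definition sign_mx N : 'M[C]_N := diag_mx (\row_j (-1) ^+ j).

Fact sign_mxK N : sign_mx N *m sign_mx N = 1%:M.
Proof.
rewrite mulmx_diag -diag_const_mx; congr diag_mx.
by apply/rowP => j; rewrite !mxE -expr2 sqrr_sign.
Qed.

Fact sign_poly_rV N (v : 'rV[C]_N) : sign_poly (rVpoly v) = rVpoly (v *m sign_mx N).
Proof.
apply/polyP => k; rewrite coef_sign_poly !coef_rVpoly.
case: insubP => [i _ <-|_]; last by rewrite mulr0.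
by rewrite mul_mx_diag !mxE mulrC.
Qed.

Fact row_free_sign n N (A : 'M[C]_(n, N)) : row_free A -> row_free (A *m sign_mx N).
Proof.
by move=> fA; rewrite /row_free mxrankMfree // row_free_unit; case/mulmx1_unit: (sign_mxK N).
Qed.

Fact row_span_sign n N (A : 'M[C]_(n, N)) :
  sign_poly @` row_span A = row_span (A *m sign_mx N).
Proof.
rewrite /row_span image_comp; apply: eq_imagel => c _ /=.
by rewrite sign_poly_rV mulmxA.
Qed.

Fact sign_plane n (W : Gr n) : is_plane n (sign_poly @` W).
Proof.
have [N [A [fA ->]]] := planeP W; exists N, (A *m sign_mx N).
by rewrite row_span_sign row_free_sign.
Qed.

Definition Gr_act n (W : Gr n) : Gr n := Plane (sign_plane W).

Fact Gr_actK n : involutive (@Gr_act n).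
Proof.
move=> W; apply: Gr_inj; rewrite /= image_comp -[RHS]image_id.
by apply: eq_imagel => p _ /=; rewrite sign_polyK.
Qed.

Definition sign_frame n N (A : frame n N) : frame n N :=
  @exist _ (fun B => B \in [set A : 'M[C]_(n, N) | row_free A]) (val A *m sign_mx N)
    (mem_set (row_free_sign (set_valP A))).

Fact sign_frame_continuous n N : continuous (@sign_frame n N).
Proof.
apply: continuous_to_set_type; apply: continuous_mx => i j /=.
under [X in continuous X]funext do rewrite mxE.
apply: continuous_sum => k; apply: continuous_mulr; exact: continuous_coord_val.
Qed.

Fact Gr_act_continuous n : continuous (@Gr_act n).
Proof.
apply/continuousP => U oU; rewrite Gr_openE => N.
have -> : @frame_span n N @^-1` (@Gr_act n @^-1` U) =
          @sign_frame n N @^-1` (@frame_span n N @^-1` U).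
  apply/funext => A /=; congr (U _); apply: Gr_inj; exact: row_span_sign.
by move/continuousP: (@sign_frame_continuous n N); apply; exact: oU.
Qed.
HB.instance Definition _ n := isContinuous.Build _ _ (@Gr_act n) (@Gr_act_continuous n).

Definition BGU n : C2space := C2Space (@Gr_actK n).

End Grassmannian.

Fact continuous_Complex (R : realType) (T : topologicalType) (f g : T -> R) :
  continuous f -> continuous g ->
  continuous ((fun t => Complex (f t) (g t)) : T -> (R[i] : numFieldType)).
Proof.
move=> fc gc t; apply/cvgrPdist_lt => /= e.
rewrite ltcE /= => /andP[/eqP e0 e_gt0].
have e2 : 0 < complex.Re e / 2 by rewrite divr_gt0.
near=> s; rewrite ltcE /= e0 eqxx /=.
have fs : `|f t - f s| < complex.Re e / 2.
  by near: s; move/cvgrPdist_lt: (fc t); apply.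
have gs : `|g t - g s| < complex.Re e / 2.
  by near: s; move/cvgrPdist_lt: (gc t); apply.
rewrite [ltRHS]splitr; apply: le_lt_trans (ltrD fs gs).
rewrite -ler_sqr ?nnegrE ?sqrtr_ge0 ?addr_ge0 // sqr_sqrtr ?addr_ge0 ?sqr_ge0 //.
have sq (x : R) : x ^+ 2 = `|x| ^+ 2 by rewrite real_normK ?num_real.
by rewrite (sq (f t - f s)) (sq (g t - g s)) sqrrD lerD2r lerDl mulrn_wge0 // mulr_ge0.
Unshelve. all: by end_near. Qed.

Section Chern.
Variable R : realType.

Definition B_GU n : C2space := BGU R[i] n.
Definition BU n : topologicalType := B_GU n.

(* A singular 2-simplex of CP^1 in BU(1), in homogeneous coordinates
   [t0 t1 t2 : (t1 - t0) + i (t2 - t0)]. It collapses the boundary of the simplex to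
   the point [0 : 1] and maps the interior homeomorphically, preserving the
   orientation, onto the complement of this point. Hence its difference with the
   constant simplex at [0 : 1] is a cycle that represents the fundamental class of
   CP^1; cp1_eval is evaluation on it. *)
Section ProjectiveLine.

Definition cp1_row (t : simplex R 2) : 'rV[R[i]]_2 :=
  let x := val t 0 in
  \row_j if j == 0 then real_complex R (x 0 * x 1 * x 2)
         else Complex (x 1 - x 0) (x 2 - x 0).

Fact cp1_row_free t : row_free (cp1_row t).
Proof.
rewrite /row_free rank_rV; suff -> : cp1_row t != 0 by [].
have [_] := set_valP t; rewrite !big_ord_recl big_ord0 addr0.
set a := set_val t 0 _; set b := set_val t 0 _; set c := set_val t 0 _ => abc.
apply/eqP => /rowP r0.
have := r0 1; rewrite !mxE /= => -[/eqP + /eqP]; rewrite !subr_eq0.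
have := r0 0; rewrite !mxE /= => -[/eqP].
have -> : val t 0 1 = b by congr (val t 0 _); exact: val_inj.
have -> : val t 0 2 = c by congr (val t 0 _); exact: val_inj.
rewrite -[val t 0 0]/a => abc0 /eqP ba /eqP ca.
move: abc abc0; rewrite ba ca !mulf_eq0 !orbb => + /eqP a0.
by rewrite a0 !addr0 => /esym/eqP; rewrite oner_eq0.
Qed.

Definition cp1_frame (t : simplex R 2) : frame R[i] 1 2 :=
  @exist _ (fun B => B \in [set A : 'M[R[i]]_(1, 2) | row_free A]) (cp1_row t)
    (mem_set (cp1_row_free t)).

Definition cp1_map (t : simplex R 2) : BU 1 := frame_span (cp1_frame t).

Fact cp1_map_continuous : continuous cp1_map.
Proof.
move=> t0; apply: (@cvg_comp _ _ _ cp1_frame (@frame_span R[i] 1 2)); last first.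
  exact: frame_span_continuous.
apply: continuous_to_set_type; apply: continuous_mx => i j /=.
under [X in continuous X]funext do rewrite mxE.
have xc k : continuous (fun t : simplex R 2 => val t 0 k).
  exact: continuous_coord_val.
have xB k l : continuous (fun t : simplex R 2 => val t 0 k - val t 0 l).
  by move=> t; exact: (continuousB (xc k t) (xc l t)).
case: (j == 0); apply: continuous_Complex => //; last exact: cst_continuous.
by move=> t; exact: (continuousM (continuousM (xc 0 t) (xc 1 t)) (xc 2 t)).
Qed.
HB.instance Definition _ := isContinuous.Build _ _ cp1_map cp1_map_continuous.

Definition cp1_simplex : sing R (BU 1) 2 := cp1_map.

Definition cp1_eval (u : HQ R (BU 1) 2) : rat :=
  rep u cp1_simplex - rep u (subsimplex (fun=> ord0) cp1_simplex).

End ProjectiveLine.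

Definition HQcast (X : topologicalType) p q (e : p = q) (u : HQ R X p) : HQ R X q :=
  ecast r (HQ R X r) e u.

Fact doubleBK k (i : 'I_k.+1) : (i.*2 + (k - i).*2 = k.*2)%N.
Proof. by rewrite -doubleD subnKC // -ltnS. Qed.

(* c n i is the i-th Chern class of the tautological (universal) n-plane bundle on
   BU(n). In the Whitney formula the bundle classified by D is the sum of the
   subbundles classified by E and F of the trivial bundle with fibre C^oo; the sum is
   direct since its fibres have dimension m + n. *)
Record is_chern (c : forall n i, HQ R (BU n) i.*2) : Prop := IsChern {
  chern0 : forall n, c n 0 = HQone R (BU n);
  chern_gt : forall n i, (n < i)%N -> c n i = 0;
  chern_whitney : forall (T : topologicalType) m n (E : continuousType T (BU m))
    (F : continuousType T (BU n)) (D : continuousType T (BU (m + n))),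
    (forall t, plane_set (D t) =
       [set u + v | u in plane_set (E t) & v in plane_set (F t)]) ->
    forall k, pullback D (c (m + n)%N k) =
      \sum_(i < k.+1) HQcast (doubleBK i)
        (cup (pullback E (c m i)) (pullback F (c n (k - i)%N)));
  chern_normalized : cp1_eval (c 1 1) = -1 }.

End Chern.

Section Split.
Variables (R : realType) (X : C2space).

(* Sections of Res by a map of graded unital Q-algebras *)
Definition algebra_splitting (s : forall p, {linear HQ R X p -> HG R X p}) : Prop :=
  [/\ forall p, cancel (s p) (@Res R X p),
      s 0 (HQone R X) = HGone R X &
      forall p q (u : HQ R X p) (v : HQ R X q), s _ (cup u v) = HGcup (s p u) (s q v)].

(* Sections of Res by a map of graded A(G/G)-modules; A(G/G) acts on H^*(X) through
   its restriction to A(G/e) = rat. *)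
Definition module_splitting (s : forall p, {linear HQ R X p -> HG R X p}) : Prop :=
  (forall p, cancel (s p) (@Res R X p)) /\
  (forall p a (u : HQ R X p), s p (burnside_res a *: u) = HGact a (s p u)).

End Split.

(* Main.v *)
From HB Require Import structures.
Require Import Defs.
From mathcomp Require Import all_boot all_order all_algebra.
From mathcomp Require Import all_classical all_reals all_analysis.
From mathcomp Require Import complex zify ring lra.
(* The name diff also denotes the total derivative of normed module theory; the
   last import makes it the singular coboundary. *)
Require Import Defs.

(** The space BU(n) of n-planes in C^oo = {poly C} carries the involution induced by
    p(X) |-> p(-X). Since -1 is joined to 1 by a path in C^*, this involution is
    homotopic to the identity through the maps W |-> {p(zX) | p in W}, so it acts as
    the identity on rational cohomology, and this is all that is needed: for every
    C_2-space X with an action homotopic to the identity, the restriction from Bredon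
    to singular cohomology is split.

    Indeed, let f be a singular cocycle of X and tau the involution. The average
    (f + tau^* f) / 2 is an invariant cocycle; it is cohomologous to f because
    tau^* f - f is the coboundary of the prism operator applied to f
    (prism_homotopy, avg_class). An invariant cochain g becomes a Bredon cochain once
    values in A(G/G) that restrict to g are chosen on the simplices of the fixed space.
    For this take s |-> g(s) e, where e is an element of A(G/G) with restriction 1
    (avg_section). The resulting map of complexes induces a linear section of Res
    (splitting), whose multiplicative properties are those of e:
    - for e = 1 it is a morphism of unital algebras. Averaging is not multiplicative,
      but cohomology classes have invariant representatives, on which the section is
      multiplicative on cochains (splitting_cup);
    - for e = x/2, which satisfies a e = res(a) e, it is A(G/G)-linear
      (splitting_act).
    These are two different sections, since the first property forces e = 1 and the second
    e = x/2.

    The topological part is the continuity of the homotopy Gr x R -> Gr: the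
    Grassmannian has the topology of a colimit of quotients, which is compatible with
    the product with R because R is locally compact (rotate_continuous).

    Chern classes are classes in the cohomology of BU(n), so they lift because Res is
    surjective. *)

Set Implicit Arguments.
Unset Strict Implicit.
Unset Printing Implicit Defensive.

Import Order.TTheory GRing.Theory Num.Theory.
Import numFieldNormedType.Exports.
Local Open Scope classical_set_scope.
Local Open Scope ring_scope.
Local Open Scope quotient_scope.

(** * Cohomology classes, induced maps and products *)

Section CohomologyClasses.
Variables (K : pzRingType) (C : nat -> lmodType K).
Variable d : forall p, {linear C p -> C p.+1}.

Lemma d_rep p (u : cohomology d p) : d p (rep u) = 0.
Proof. by apply/eqP; exact: (valP (repr u)). Qed.

Lemma repK p (u : cohomology d p) : class d (rep u) = u.
Proof. by rewrite /class /rep valKd reprK. Qed.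

Lemma is_coboundaryB p (y z : C p) :
  is_coboundary d y -> is_coboundary d z -> is_coboundary d (y - z).
Proof.
case: p y z => [|p] y z /=; first by move=> -> ->; rewrite subrr.
by move=> [a <-] [b <-]; exists (a - b); rewrite linearB.
Qed.

Lemma class_eqP p (y z : C p) : d p y = 0 -> d p z = 0 ->
  class d y = class d z <-> is_coboundary d (y - z).
Proof.
move=> dy dz; have cy : y \in @cocycle_pred K C d p by apply/eqP.
have cz : z \in @cocycle_pred K C d p by apply/eqP.
rewrite /class; split=> [/eqP|yz].
  by rewrite -Quotient.idealrBE => /asboolP; rewrite raddfB /= !insubdK.
by apply/eqP; rewrite -Quotient.idealrBE; apply/asboolP; rewrite raddfB /= !insubdK.
Qed.

Lemma class_linear p a (y z : C p) : d p y = 0 -> d p z = 0 ->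
  class d (a *: y + z) = a *: class d y + class d z.
Proof.
move=> dy dz; have cy : y \in @cocycle_pred K C d p by apply/eqP.
have cz : z \in @cocycle_pred K C d p by apply/eqP.
have -> : a *: class d y = cohomology_scale a (class d y) by [].
rewrite /class pi_scale -raddfD.
congr (\pi_(_) _); apply: val_inj; rewrite insubdK ?rpredD ?rpredZ //=.
by rewrite !insubdK.
Qed.

Lemma classZ p a (y : C p) : d p y = 0 -> class d (a *: y) = a *: class d y.
Proof.
move=> dy; have class0 : class d (0 : C p) = 0.
  by rewrite /class (valKd _ (0 : cocycle d p)) raddf0.
by rewrite -[a *: y]addr0 class_linear ?linear0 // class0 addr0.
Qed.

Lemma rep_class p (z : C p) : d p z = 0 -> is_coboundary d (rep (class d z) - z).
Proof. by move=> dz; apply/class_eqP; rewrite ?d_rep ?repK. Qed.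

End CohomologyClasses.

Section InducedMap.
Variables (K : pzRingType) (C D : nat -> lmodType K).
Variables (dC : forall p, {linear C p -> C p.+1}) (dD : forall p, {linear D p -> D p.+1}).
Variable phi : forall p, {linear C p -> D p}.
Hypothesis phi_d : forall p f, dD p (phi p f) = phi p.+1 (dC p f).

Definition induced p (u : cohomology dC p) : cohomology dD p :=
  class dD (phi p (rep u)).

Let phi_cocycle p f : dC p f = 0 -> dD p (phi p f) = 0.
Proof. by rewrite phi_d => ->; rewrite linear0. Qed.

Lemma phi_coboundary p (f : C p) : is_coboundary dC f -> is_coboundary dD (phi p f).
Proof.
case: p f => [|p] f /=; first by move=> ->; rewrite linear0.
by move=> [y <-]; exists (phi p y); rewrite phi_d.
Qed.

Lemma induced_class p (z : C p) : dC p z = 0 -> induced (class dC z) = class dD (phi p z).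
Proof.
move=> dz; apply/class_eqP; rewrite ?phi_cocycle ?d_rep //.
by rewrite -linearB; apply: phi_coboundary; exact: rep_class.
Qed.

Lemma induced_linear p : linear (@induced p).
Proof.
move=> a u v; rewrite -{1}(repK u) -{1}(repK v) -class_linear ?d_rep //.
rewrite induced_class ?linearP ?d_rep ?scaler0 ?addr0 //.
by rewrite class_linear // phi_cocycle ?d_rep.
Qed.
HB.instance Definition _ p :=
  GRing.isLinear.Build K (cohomology dC p) (cohomology dD p) _ (@induced p)
    (@induced_linear p).

Definition lin_induced p : {linear cohomology dC p -> cohomology dD p} := @induced p.

End InducedMap.

(** The product mul p q m lands in an arbitrary degree m, although it is meaningful only
    for m = p + q. This makes the two terms of the Leibniz rule elements of the same
    type, where the degrees p.+1 + q and p + q.+1 would need a cast. *)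
Section ProductClasses.
Variables (K : pzRingType) (C : nat -> lmodType K).
Variable d : forall p, {linear C p -> C p.+1}.
Variable mul : forall p q m, C p -> C q -> C m.
Hypothesis mulBl : forall p q m (f f' : C p) (g : C q),
  mul m (f - f') g = mul m f g - mul m f' g.
Hypothesis mulBr : forall p q m (f : C p) (g g' : C q),
  mul m f (g - g') = mul m f g - mul m f g'.
Hypothesis leibniz : forall p q (f : C p) (g : C q),
  d (p + q) (mul (p + q) f g) =
    mul (p + q).+1 (d p f) g + (-1) ^+ p *: mul (p + q).+1 f (d q g).

Let mul0l p q m (g : C q) : mul m (0 : C p) g = 0.
Proof. by rewrite -(subrr 0) mulBl subrr. Qed.

Let mul0r p q m (f : C p) : mul m f (0 : C q) = 0.
Proof. by rewrite -(subrr 0) mulBr subrr. Qed.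

Lemma mul_cocycle p q (f : C p) (g : C q) : d p f = 0 -> d q g = 0 ->
  d (p + q) (mul (p + q) f g) = 0.
Proof. by move=> df dg; rewrite leibniz df dg mul0l mul0r scaler0 addr0. Qed.

Lemma mul_coboundaryl p q (f : C p) (g : C q) :
  is_coboundary d f -> d q g = 0 -> is_coboundary d (mul (p + q) f g).
Proof.
case: p f => [|p] f /=; first by case: q g => [|q] g -> _;
  rewrite mul0l //; exists 0; rewrite linear0.
move=> [y <-] dg; exists (mul (p + q) y g).
by rewrite leibniz dg mul0r scaler0 addr0.
Qed.

Lemma mul_coboundaryr p q (f : C p) (g : C q) :
  d p f = 0 -> is_coboundary d g -> is_coboundary d (mul (p + q) f g).
Proof.
move=> df; case: q g => [|q] g /=.
  by move=> ->; rewrite mul0r; case: (p + 0)%N => //= m; exists 0; rewrite linear0.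
move=> [y <-]; rewrite addnS /=; exists ((-1) ^+ p *: mul (p + q) f y).
by rewrite linearZ /= leibniz df mul0l add0r scalerA -expr2 sqrr_sign scale1r.
Qed.

Lemma mul_class p q (f : C p) (g : C q) : d p f = 0 -> d q g = 0 ->
  class d (mul (p + q) (rep (class d f)) (rep (class d g))) =
  class d (mul (p + q) f g).
Proof.
move=> df dg; apply/class_eqP; rewrite ?mul_cocycle ?d_rep //.
set f' := rep _; set g' := rep _.
have -> : mul (p + q) f' g' - mul (p + q) f g =
    mul (p + q) (f' - f) g' - mul (p + q) f (g - g').
  by rewrite mulBl mulBr opprB addrA addrNK.
apply: is_coboundaryB.
  by apply: mul_coboundaryl; [exact: rep_class | exact: d_rep].
apply: mul_coboundaryr => //.
by apply/class_eqP; rewrite ?d_rep ?repK.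
Qed.

End ProductClasses.

(** * Singular simplices and the cup product *)

Section Simplices.
Variable R : realType.

Lemma affine_comp p q r (a : 'I_p.+1 -> 'I_q.+1) (b : 'I_q.+1 -> 'I_r.+1) (t : simplex R p) :
  affine b (affine a t) = affine (b \o a) t.
Proof.
apply: val_inj; apply/rowP => j; rewrite /= !mxE.
under eq_bigr do rewrite mxE.
rewrite [RHS](partition_big a (fun k => b k == j)) //=; apply: eq_bigr => k bk.
by apply: eq_bigl => i; case: eqP => [->|]; rewrite ?bk ?andbF.
Qed.

Lemma affine_id p (t : simplex R p) : affine id t = t.
Proof. by apply: val_inj; apply/rowP => j; rewrite /= mxE big_pred1_eq. Qed.

Lemma subsimplex_comp (X : topologicalType) p q r (a : 'I_p.+1 -> 'I_q.+1)
    (b : 'I_q.+1 -> 'I_r.+1) (s : sing R X r) :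
  subsimplex a (subsimplex b s) = subsimplex (b \o a) s.
Proof. by apply/continuousEP => t /=; rewrite affine_comp. Qed.

Lemma eq_subsimplex (X : topologicalType) p q (a b : 'I_p.+1 -> 'I_q.+1) (s : sing R X q) :
  a =1 b -> subsimplex a s = subsimplex b s.
Proof. by move=> /funext ->. Qed.

Lemma push_subsimplex (X Y : topologicalType) (f : continuousType X Y) p q
    (a : 'I_p.+1 -> 'I_q.+1) (s : sing R X q) :
  push f (subsimplex a s) = subsimplex a (push f s).
Proof. exact/continuousEP. Qed.

End Simplices.

(** The signed sum behind the Leibniz rule of the cup product: a is the sequence of faces
    of the front part of a simplex and c that of the back part. Removing
    the last vertex of the front or the first vertex of the back gives the same term
    a p.+1 * c 0, which occurs with opposite signs and cancels. *)
Lemma leibniz_telescope (K : pzRingType) (A : algType K) p q (a c : nat -> A) :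
  (\sum_(0 <= i < p.+2) (-1) ^+ i *: a i) * c 0%N +
    (-1) ^+ p *: (a p.+1 * \sum_(0 <= i < q.+2) (-1) ^+ i *: c i) =
  \sum_(0 <= i < p.+1) (-1) ^+ i *: (a i * c 0%N) +
    \sum_(1 <= i < q.+2) (-1) ^+ (p + i) *: (a p.+1 * c i).
Proof.
rewrite [X in X * _]big_nat_recr //= [X in _ *: (_ * X)]big_ltn //.
rewrite mulrDl mulrDr scalerDr expr0 scale1r exprS mulN1r scaleNr mulNr -scalerAl.
rewrite addrA addrNK mulr_suml mulr_sumr scaler_sumr.
congr (_ + _); apply: eq_bigr => i _; first by rewrite scalerAl.
by rewrite -scalerAr scalerA exprD.
Qed.

Section CupProduct.
Variables (R : realType) (A : algType rat) (X : topologicalType).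

(** The Alexander-Whitney product with a free total degree m: cupm (p + q) f g is
    convertible to cupc f g. *)
Definition cupm p q m (f : cochain R A X p) (g : cochain R A X q) : cochain R A X m :=
  fun s => f (subsimplex (fun k => inord k) s) *
           g (subsimplex (fun k => inord (p + k)) s).
Arguments cupm {p q} m f g.

Lemma cupmBl p q m (f f' : cochain R A X p) (g : cochain R A X q) :
  cupm m (f - f') g = cupm m f g - cupm m f' g.
Proof. by apply/funext => s; exact: mulrBl. Qed.

Lemma cupmBr p q m (f : cochain R A X p) (g g' : cochain R A X q) :
  cupm m f (g - g') = cupm m f g - cupm m f g'.
Proof. by apply/funext => s; exact: mulrBr. Qed.

Lemma face_nat p (i : 'I_p.+2) (s : sing R X p.+1) q (a : nat -> nat) :
  (forall k : 'I_q.+1, (a k <= p)%N) ->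
  subsimplex (fun k : 'I_q.+1 => inord (a k)) (face i s) =
  subsimplex (fun k : 'I_q.+1 => inord (bump i (a k))) s.
Proof.
move=> ap; rewrite /face subsimplex_comp; apply: eq_subsimplex => k /=.
apply: val_inj; rewrite /= inordK ?ltnS // inordK // ltnS /bump.
by case: (i <= _)%N; rewrite ?add0n ?add1n ?ltnS // leqW.
Qed.

Lemma subsimplex_face p (i : 'I_p.+2) m (s : sing R X m) (a : nat -> nat) :
  face i (subsimplex (fun k : 'I_p.+2 => inord (a k)) s) =
  subsimplex (fun k : 'I_p.+1 => inord (a (bump i k))) s.
Proof. by rewrite /face subsimplex_comp; apply: eq_subsimplex. Qed.

Lemma diff_cupm p q (f : cochain R A X p) (g : cochain R A X q) :
  diff (cupm (p + q) f g) =
  cupm (p + q).+1 (diff f) g + (-1) ^+ p *: cupm (p + q).+1 f (diff g).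
Proof.
apply/funext => s.
pose F (a : nat -> nat) := f (subsimplex (fun k => inord (a k)) s).
pose G (a : nat -> nat) := g (subsimplex (fun k => inord (a k)) s).
have eqF a b : (forall k, (k <= p)%N -> a k = b k) -> F a = F b.
  move=> ab; congr f; apply: eq_subsimplex => k; congr inord; apply: ab.
  by rewrite -ltnS.
have eqG a b : (forall k, a k = b k) -> G a = G b.
  by move=> ab; congr g; apply: eq_subsimplex => k; congr inord.
have dF : diff f (subsimplex (fun k => inord k) s) =
    \sum_(0 <= i < p.+2) (-1) ^+ i *: F (bump i).
  rewrite big_mkord; apply: eq_bigr => i _.
  by rewrite (@subsimplex_face _ _ _ _ id).
have dG : diff g (subsimplex (fun k => inord (p + k)) s) =
    \sum_(0 <= i < q.+2) (-1) ^+ i *: G (fun k => p + bump i k)%N.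
  rewrite big_mkord; apply: eq_bigr => i _.
  by rewrite (@subsimplex_face _ _ _ _ (addn p)).
have F0 : F (bump p.+1) = F id.
  by apply: eqF => k kp; rewrite /bump ltnNge kp.
have G0 : G (fun k => p + bump 0 k)%N = G (addn p.+1).
  by apply: eqG => k; rewrite /bump add1n addnS addSn.
have := leibniz_telescope p q (fun i => F (bump i)) (fun i => G (fun k => p + bump i k)%N).
rewrite F0 G0 -dF -dG => /esym; apply: etrans.
(* face i of s is a face of its front for i <= p and of its back for i > p *)
transitivity (\sum_(0 <= i < (p + q).+2)
   (-1) ^+ i *: (F (bump i) * G (fun k => bump i (p + k)))).
  rewrite big_mkord; apply: eq_bigr => i _; congr (_ *: (f _ * g _)).
    rewrite (@face_nat _ _ _ _ id) // => k.
    by rewrite (leq_trans _ (leq_addr _ _)) // -ltnS.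
  rewrite (@face_nat _ _ _ _ (addn p)) // => k.
  by rewrite leq_add2l -ltnS.
rewrite (@big_cat_nat _ _ _ p.+1) //=; last by rewrite ltnW // ltnS ltnS leq_addr.
congr (_ + _).
  apply: eq_big_nat => i /andP[_ ip]; congr (_ *: (_ * _)); apply: eqG => k.
  by rewrite /bump (leq_trans _ (leq_addr _ _)) // add1n addSn.
rewrite -[p.+1]add1n big_addn.
have -> : ((p + q).+2 - p = q.+2)%N by rewrite -!addnS addKn.
apply: eq_big_nat => i /andP[i0 _]; rewrite [(i + p)%N]addnC.
congr (_ *: (_ * _)); first apply: eqF => k kp.
  by rewrite /bump leqNgt (leq_ltn_trans kp) // -addn1 leq_add2l.
by apply: eqG => k; rewrite /bump leq_add2l addnCA.
Qed.

End CupProduct.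
Arguments cupm {R A X p q} m f g.

(** * Homotopy invariance *)

(** The alternating sum in the proof that the prism operator is a chain homotopy. F i j is
    the term of face j of prism i, and G k l that of prism l over face k of the
    base. The faces with j < i or j > i + 1 lie over the boundary of the base and cancel
    with the G k l; the two inner faces shared by consecutive prisms telescope, which
    leaves the top and the bottom. *)
Lemma prism_telescope (V : lmodType rat) p (F G : nat -> nat -> V) :
  (forall i j, (j < i <= p)%N -> F i j = G j i.-1) ->
  (forall i j, (i.+1 < j <= p.+1)%N -> F i j = G j.-1 i) ->
  (forall i, (i < p)%N -> F i i.+1 = F i.+1 i.+1) ->
  \sum_(0 <= i < p.+1) (-1) ^+ i *: (\sum_(0 <= j < p.+2) (-1) ^+ j *: F i j) +
  \sum_(0 <= k < p.+1) (-1) ^+ k *: (\sum_(0 <= l < p) (-1) ^+ l *: G k l) =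
  F 0%N 0%N - F p p.+1.
Proof.
move=> FGl FGr Fd.
pose L i := \sum_(0 <= j < i) (-1) ^+ (i + j) *: F i j.
pose U i := \sum_(i.+2 <= j < p.+2) (-1) ^+ (i + j) *: F i j.
have -> : \sum_(0 <= i < p.+1) (-1) ^+ i *: (\sum_(0 <= j < p.+2) (-1) ^+ j *: F i j) =
    \sum_(0 <= i < p.+1) (L i + (F i i - F i i.+1 + U i)).
  apply: eq_big_nat => i /andP[_ ip]; rewrite scaler_sumr.
  rewrite (@big_cat_nat _ _ _ i) //=; last by lia.
  rewrite (@big_ltn _ _ _ i) ?(@big_ltn _ _ _ i.+1); try by lia.
  rewrite /L /U !scalerA -!exprD -addrA; congr (_ + (_ + (_ + _))).
  - by apply: eq_bigr => j _; rewrite scalerA -exprD.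
  - by rewrite -signr_odd oddD addbb scale1r.
  - by rewrite -signr_odd addnS /= oddD addbb expr1 scaleN1r.
  - by apply: eq_bigr => j _; rewrite scalerA -exprD.
have -> : \sum_(0 <= k < p.+1) (-1) ^+ k *: (\sum_(0 <= l < p) (-1) ^+ l *: G k l) =
    - (\sum_(0 <= i < p.+1) (L i + U i)).
  under eq_bigr do rewrite scaler_sumr.
  rewrite exchange_big_nat /= big_split /= big_nat_recl // [X in _ + X]big_nat_recr //=.
  have -> : L 0%N = 0 by rewrite /L big_geq.
  have -> : U p = 0 by rewrite /U big_geq.
  rewrite add0r addr0 -big_split -sumrN /=.
  apply: eq_big_nat => l /andP[_ lp].
  rewrite (@big_cat_nat _ _ _ l.+1) //=; last by lia.
  rewrite opprD -!sumrN; congr (_ + _).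
    apply: eq_big_nat => k /andP[_ kl]; rewrite FGl; last by lia.
    by rewrite scalerA -exprD addSn exprS mulN1r scaleNr opprK addnC.
  rewrite [RHS]big_add1 /=; apply: eq_big_nat => k /andP[kl kp]; rewrite FGr; last by lia.
  by rewrite scalerA -exprD addnS exprS mulN1r scaleNr opprK addnC.
rewrite -sumrB; under eq_bigr do rewrite addrCA addrK.
elim: (p) Fd => [|m IH] Fd; first by rewrite big_nat1.
rewrite big_nat_recr //= IH; last by move=> i im; apply: Fd; rewrite ltnW.
by rewrite Fd // addrA subrK.
Qed.

Section Prism.
Variables (R : realType) (X : topologicalType) (H : X * R -> X).
Hypothesis Hc : continuous H.

(** A simplex of X x R whose first component is the simplex s of X, precomposed with the
    affine map that is given by a on vertices, and whose second component is affine with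
    value 1 at the vertices in b and 0 at the others; H maps it to X. *)
Section Track.
Variables (p q : nat) (s : sing R X q) (a : 'I_p.+1 -> 'I_q.+1) (b : pred 'I_p.+1).

Definition track (t : simplex R p) : X :=
  H (s (affine a t), \sum_(i | b i) val t 0 i).

Lemma track_continuous : continuous track.
Proof.
have sc : continuous (fun t => s (affine a t)).
  move=> t; apply: (@cvg_comp _ _ _ (affine a) s); first exact: affine_continuous.
  exact: cts_fun.
have bc : continuous (fun t : simplex R p => \sum_(i | b i) val t 0 i).
  apply: (@continuous_sum (simplex R p) R _ _ b (fun i t => val t 0 i)) => i.
  exact: continuous_coord_val.
move=> t; apply: (@cvg_comp _ _ _ (fun t => (s (affine a t), \sum_(i | b i) val t 0 i)) H).
  exact: cvg_pair (sc t) (bc t).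
exact: Hc.
Qed.
HB.instance Definition _ := isContinuous.Build _ _ track track_continuous.

Definition track_simplex : sing R X p := track.
End Track.

Lemma eq_track p q (s : sing R X q) (a a' : 'I_p.+1 -> 'I_q.+1) (b b' : pred 'I_p.+1) :
  a =1 a' -> b =1 b' -> track_simplex s a b = track_simplex s a' b'.
Proof. by move=> /funext -> /funext ->. Qed.

Lemma subsimplex_track p q r (s : sing R X r) (a : 'I_q.+1 -> 'I_r.+1) (b : pred 'I_q.+1)
    (c : 'I_p.+1 -> 'I_q.+1) :
  subsimplex c (track_simplex s a b) = track_simplex s (a \o c) (b \o c).
Proof.
apply/continuousEP => t /=; rewrite /track affine_comp; congr (H (_, _)).
under eq_bigr do rewrite mxE.
rewrite [RHS](partition_big c b) //; apply: eq_bigr => j bj.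
by apply: eq_bigl => i /=; case: eqP => [->|]; rewrite ?bj ?andbF.
Qed.

Lemma track_subsimplex p q r (s : sing R X r) (a : 'I_p.+1 -> 'I_q.+1) (b : pred 'I_p.+1)
    (c : 'I_q.+1 -> 'I_r.+1) :
  track_simplex (subsimplex c s) a b = track_simplex s (c \o a) b.
Proof. by apply/continuousEP => t /=; rewrite /track /= affine_comp. Qed.

Variables (h0 h1 : continuousType X X).
Hypothesis H0 : forall x, H (x, 0) = h0 x.
Hypothesis H1 : forall x, H (x, 1) = h1 x.

Lemma track0 p (s : sing R X p) : track_simplex s id pred0 = push h0 s.
Proof. by apply/continuousEP => t /=; rewrite /track big_pred0_eq affine_id H0. Qed.

Lemma track1 p (s : sing R X p) : track_simplex s id predT = push h1 s.
Proof.
apply/continuousEP => t /=; rewrite /track affine_id -H1; congr (H (_, _)).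
by have [] := set_valP t.
Qed.

Variable M : lmodType rat.

(** Prism i has the vertices 0, ..., i at time 0 and i, ..., p at time 1. *)
Definition prism p (f : cochain R M X p.+1) : cochain R M X p :=
  fun s => \sum_(i < p.+1) (-1) ^+ i *:
    f (track_simplex s (fun k : 'I_p.+2 => inord (unbump i k)) (fun k => (i < k)%N)).

(** The composite of the prism operator and the coboundary; in degree 0 the prism operator
    would land in degree -1. *)
Definition boundary_prism p : cochain R M X p -> cochain R M X p :=
  match p with
  | 0 => fun=> 0
  | p'.+1 => fun f => diff (prism f)
  end.

Lemma prism_homotopy p (f : cochain R M X p) (s : sing R X p) :
  prism (diff f) s + boundary_prism f s = f (push h1 s) - f (push h0 s).
Proof.
pose F i j := f (track_simplex s (fun k : 'I_p.+1 => inord (unbump i (bump j k)))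
  (fun k => (i < bump j k)%N)).
pose G i j := f (track_simplex s (fun k : 'I_p.+1 => inord (bump i (unbump j k)))
  (fun k => (j < k)%N)).
have eqfs (a a' : nat -> nat) (b b' : pred nat) :
    (forall k, (k <= p)%N -> a k = a' k /\ b k = b' k) ->
    f (track_simplex s (fun k : 'I_p.+1 => inord (a k)) (fun k => b k)) =
    f (track_simplex s (fun k : 'I_p.+1 => inord (a' k)) (fun k => b' k)).
  move=> e; congr f; apply: eq_track => k; have [|ea eb] := e k.
  - by rewrite -ltnS.
  - by rewrite ea.
  - by rewrite -ltnS.
  - by rewrite eb.
have -> : prism (diff f) s =
    \sum_(0 <= i < p.+1) (-1) ^+ i *: (\sum_(0 <= j < p.+2) (-1) ^+ j *: F i j).
  rewrite big_mkord; apply: eq_bigr => i _; rewrite big_mkord; congr (_ *: _).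
  apply: eq_bigr => j _; congr (_ *: f _); rewrite /face subsimplex_track.
  exact: eq_track.
have -> : boundary_prism f s =
    \sum_(0 <= k < p.+1) (-1) ^+ k *: (\sum_(0 <= l < p) (-1) ^+ l *: G k l).
  rewrite /G {F G eqfs}; case: p f s => [|p] f s.
    by rewrite big_nat1 big_geq // scaler0.
  rewrite big_mkord; apply: eq_bigr => i _; rewrite big_mkord; congr (_ *: _).
  apply: eq_bigr => j _; congr (_ *: f _); rewrite /face track_subsimplex.
  apply: eq_track => k //=; apply: val_inj => /=.
  have := ltn_ord k; have := ltn_ord i; have := ltn_ord j.
  move=> jl il kl; have jk : (unbump j k < p.+1)%N by rewrite /unbump; lia.
  by rewrite !inordK // /bump; lia.
rewrite prism_telescope.
- congr (_ - _).
    rewrite -(track1 s); congr f; apply: eq_track => k //.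
    by rewrite (_ : unbump 0 (bump 0 k) = k) ?inord_val // /bump /unbump; lia.
  rewrite -(track0 s); congr f; apply: eq_track => k /=; have kp := ltn_ord k.
    rewrite (_ : unbump p (bump p.+1 k) = k) ?inord_val //.
    by rewrite /bump /unbump; lia.
  by rewrite /bump; lia.
- move=> i j ij; apply: (eqfs (fun k => unbump i (bump j k)) (fun k => bump j (unbump i.-1 k))
    (fun k => i < bump j k)%N (fun k => i.-1 < k)%N).
  by move=> k kp; rewrite /bump /unbump; lia.
- move=> i j ij; apply: (eqfs (fun k => unbump i (bump j k)) (fun k => bump j.-1 (unbump i k))
    (fun k => i < bump j k)%N (fun k => i < k)%N).
  by move=> k kp; rewrite /bump /unbump; lia.
- move=> i ip; apply: (eqfs (fun k => unbump i (bump i.+1 k)) (fun k => unbump i.+1 (bump i.+1 k))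
    (fun k => i < bump i.+1 k)%N (fun k => i.+1 < bump i.+1 k)%N).
  by move=> k kp; rewrite /bump /unbump; lia.
Qed.

End Prism.

(** * The rational Burnside ring *)

Lemma burnside_res_in_qpoly (p : {poly rat}) :
  burnside_res (in_qpoly burnside_modulus p) = p.[2].
Proof.
have mh := monic_mk_monic burnside_modulus.
rewrite /burnside_res [in RHS](Pdiv.RingMonic.rdivp_eq mh p) hornerD hornerM.
rewrite [in X in _ * X]mk_monic_burnside_modulus.
have -> : burnside_modulus.[2] = 0 by rewrite !hornerE -expr2 subrr.
by rewrite mulr0 add0r.
Qed.

Lemma burnside_resM (a b : AQ) : burnside_res (a * b) = burnside_res a * burnside_res b.
Proof. by rewrite [LHS]burnside_res_in_qpoly hornerM. Qed.

Lemma burnside_res1 : burnside_res 1 = 1.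
Proof. by rewrite /burnside_res hornerC. Qed.

(** The idempotent x/2 that cuts out the factor rat of A(G/G) = rat x rat on which the
    restriction is the identity *)
Definition half_x : AQ := in_qpoly burnside_modulus (2^-1 *: 'X).

Lemma burnside_res_half_x : burnside_res half_x = 1.
Proof. by rewrite burnside_res_in_qpoly hornerZ hornerX mulVf. Qed.

(** The polynomial a - a(2) is divisible by X - 2, and (X - 2) X = 0 in A(G/G). *)
Lemma mul_half_x (a : AQ) : a * half_x = burnside_res a *: half_x.
Proof.
have aE : a = in_qpoly burnside_modulus a.
  by apply: val_inj; rewrite [RHS]in_qpoly_small ?size_mk_monic.
have : root ((a : {poly rat}) - (burnside_res a)%:P) 2.
  by rewrite rootE !hornerE subrr.
case/factor_theorem => q aq.
rewrite {1}aE /half_x -in_qpolyM -in_qpolyZ; apply/eqP; rewrite -subr_eq0 -raddfB /=.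
have -> : (a : {poly rat}) * (2^-1 *: 'X) - burnside_res a *: (2^-1 *: 'X) =
    (2^-1 *: q) * mk_monic burnside_modulus.
  rewrite -[burnside_res a *: _]mul_polyC -mulrBl aq mk_monic_burnside_modulus.
  by rewrite -!scalerAr -!scalerAl -mulrA mulrBl -expr2.
apply/eqP/val_inj => /=; apply: Pdiv.RingMonic.rmodp_mull; exact: monic_mk_monic.
Qed.

(** * Extension of averaged cochains to Bredon cochains *)

Section Bredon.
Variables (R : realType) (X : C2space).
Local Notation C := (cochain R rat^o X).
Local Notation B := (bredon_cochain R X).
Local Notation dC := (@lin_diff R rat^o X).
Local Notation dB := (@lin_bredon_diff R X).
Local Notation tau := (c2_act X).
Local Notation incl := (@fixed_incl X).

Lemma push_face (Y Z : topologicalType) (f : continuousType Y Z) p (i : 'I_p.+2)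
    (s : sing R Y p.+1) : push f (face i s) = face i (push f s).
Proof. exact: push_subsimplex. Qed.

Lemma cup_class p q (f : C p) (g : C q) : diff f = 0 -> diff g = 0 ->
  cup (HQclass f) (HQclass g) = HQclass (cupc f g).
Proof.
apply: (@mul_class rat C dC (@cupm R rat^o X)) => {p q f g} p q.
- exact: cupmBl.
- exact: cupmBr.
- exact: diff_cupm.
Qed.

Lemma cupc_cocycle p q (f : C p) (g : C q) : diff f = 0 -> diff g = 0 ->
  diff (cupc f g) = 0.
Proof.
move=> df dg; apply: etrans (diff_cupm f g) _; rewrite df dg.
by apply/funext => s; rewrite -[LHS]/(0 * _ + _ *: (_ * 0)) mul0r mulr0 scaler0 addr0.
Qed.

Lemma bredonP p (b : B p) :
  (forall s, (val b).1 (push tau s) = (val b).1 s) /\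
  (forall s, burnside_res ((val b).2 s) = (val b).1 (push incl s)).
Proof. exact/asboolP/(valP b). Qed.

Fact bredon_cup_proof p q m (b : B p) (c : B q) :
  (cupm m (val b).1 (val c).1, cupm m (val b).2 (val c).2) \in @bredon_pred R X m.
Proof.
have [b1 b2] := bredonP b; have [c1 c2] := bredonP c; apply/asboolP; split=> s /=.
  by rewrite /cupm -!push_subsimplex b1 c1.
by rewrite /cupm burnside_resM b2 c2 -!push_subsimplex.
Qed.

Definition bredon_cup p q m (b : B p) (c : B q) : B m :=
  BredonCochain (bredon_cup_proof m b c).

Lemma HGclass_val p (b : B p) : HGclass (val b) = class dB b.
Proof. by rewrite /HGclass valKd. Qed.

Lemma HGcup_class p q (b : B p) (c : B q) : dB p b = 0 -> dB q c = 0 ->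
  HGcup (class dB b) (class dB c) = class dB (bredon_cup (p + q) b c).
Proof.
move=> db dc; transitivity
    (class dB (bredon_cup (p + q) (rep (class dB b)) (rep (class dB c)))).
  exact: (HGclass_val (bredon_cup (p + q) _ _)).
apply: (@mul_class rat B dB bredon_cup) db dc => {p q b c} p q.
- move=> m f f' g; apply: val_inj; congr pair; exact: cupmBl.
- move=> m f g g'; apply: val_inj; congr pair; exact: cupmBr.
- by move=> f g; apply: val_inj; congr pair; exact: diff_cupm.
Qed.

Definition avg p (f : C p) : C p := fun s => 2^-1 * (f s + f (push tau s)).

Lemma avg_inv p (f : C p) s : avg f (push tau s) = avg f s.
Proof.
rewrite /avg addrC; congr (_ * (f _ + _)).
by apply/continuousEP => t /=; rewrite c2_actK.
Qed.

Lemma diff_avg p (f : C p) : diff (avg f) = avg (diff f).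
Proof.
apply/funext => s; rewrite /avg /diff -big_split mulr_sumr; apply: eq_bigr => i _ /=.
by rewrite push_face -scalerDr scalerAr.
Qed.

Lemma avg_cocycle p (f : C p) : diff f = 0 -> diff (avg f) = 0.
Proof. by move=> df; rewrite diff_avg df; apply/funext => s; rewrite /avg addr0 mulr0. Qed.

Fact avg_section_proof (e : AQ) (e1 : burnside_res e = 1) p (f : C p) :
  (avg f, fun s => avg f (push incl s) *: e) \in @bredon_pred R X p.
Proof.
apply/asboolP; split=> s /=; first exact: avg_inv.
by rewrite linearZ /= e1 mulr1.
Qed.

Section AverageSection.
Variables (e : AQ) (e1 : burnside_res e = 1).

Definition avg_section p (f : C p) : B p := BredonCochain (avg_section_proof e1 f).

Lemma avg_section_linear p : linear (@avg_section p).
Proof.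
have avgP a (f g : C p) s : avg (a *: f + g) s = a * avg f s + avg g s.
  have avgP' (x y z w : rat) :
      2^-1 * (a * x + y + (a * z + w)) = a * (2^-1 * (x + z)) + 2^-1 * (y + w) by ring.
  exact: avgP'.
move=> a f g; apply: val_inj; congr pair; apply/funext => s.
  exact: avgP.
by rewrite avgP scalerDl -scalerA.
Qed.
HB.instance Definition _ p := GRing.isLinear.Build rat (C p) (B p) _ (@avg_section p)
  (@avg_section_linear p).

Definition lin_avg_section p : {linear C p -> B p} := @avg_section p.

Lemma avg_section_d p (f : C p) : dB p (lin_avg_section p f) = lin_avg_section p.+1 (dC p f).
Proof.
apply: val_inj; congr pair; first exact: diff_avg.
apply/funext => s; rewrite /= -diff_avg /diff scaler_suml.
by apply: eq_bigr => i _; rewrite push_face scalerA.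
Qed.

End AverageSection.

Definition res_cochain p (b : B p) : C p := (val b).1.

Fact res_cochain_linear p : linear (@res_cochain p).
Proof. by []. Qed.
HB.instance Definition _ p :=
  GRing.isLinear.Build rat (B p) (C p) _ (@res_cochain p) (@res_cochain_linear p).
Definition lin_res p : {linear B p -> C p} := @res_cochain p.

Lemma Res_class p (b : B p) : dB p b = 0 -> Res (class dB b) = HQclass (val b).1.
Proof. exact: (@induced_class _ _ _ dB dC lin_res). Qed.

Fact act_proof (a : AQ) p (b : B p) :
  (burnside_res a *: (val b).1, fun s => a * (val b).2 s) \in @bredon_pred R X p.
Proof.
have [b1 b2] := bredonP b; apply/asboolP; split=> s /=.
  by congr (_ * _); exact: b1.
by rewrite burnside_resM b2.
Qed.

Definition act_cochain a p (b : B p) : B p := BredonCochain (act_proof a b).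

Fact act_cochain_linear a p : linear (@act_cochain a p).
Proof.
move=> c b b'; apply: val_inj; congr pair; apply/funext => s.
  by rewrite /= scalerDr !scalerA mulrC.
by rewrite /= -[(c *: _ + _) s]/(c *: (val b).2 s + (val b').2 s) mulrDr -scalerAr.
Qed.
HB.instance Definition _ a p := GRing.isLinear.Build rat (B p) (B p) _ (@act_cochain a p)
  (@act_cochain_linear a p).
Definition lin_act a p : {linear B p -> B p} := @act_cochain a p.

Lemma act_d a p (b : B p) : dB p (lin_act a p b) = lin_act a p.+1 (dB p b).
Proof.
apply: val_inj; congr pair; apply/funext => s; rewrite /= /diff.
  rewrite -[(_ *: diff _) s]/(burnside_res a *: diff (val b).1 s) /diff scaler_sumr.
  by apply: eq_bigr => i _; rewrite !scalerA mulrC.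
by rewrite mulr_sumr; apply: eq_bigr => i _; rewrite -scalerAr.
Qed.

Lemma HGact_class a p (b : B p) : dB p b = 0 ->
  HGact a (class dB b) = class dB (act_cochain a b).
Proof.
move=> db; apply: etrans (@induced_class _ _ _ dB dB (lin_act a) (@act_d a) p b db).
exact: (HGclass_val (act_cochain a (rep _))).
Qed.

Section TrivialAction.
Variable H : X * R -> X.
Hypothesis Hc : continuous H.
Hypothesis H0 : forall x, H (x, 0) = x.
Hypothesis H1 : forall x, H (x, 1) = tau x.

(** The difference avg f - f is half of tau^* f - f, a coboundary by the homotopy. *)
Lemma avg_class p (f : C p) : diff f = 0 -> HQclass (avg f) = HQclass f.
Proof.
move=> df; apply/class_eqP => //; first exact: avg_cocycle.
have h s := prism_homotopy Hc (h0 := idfun) (h1 := tau) H0 H1 f s.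
have p0 s : prism Hc (diff f) s = 0.
  by rewrite df /prism big1 // => i _; rewrite scaler0.
have -> : avg f - f = 2^-1 *: boundary_prism Hc f.
  apply/funext => s; rewrite -[RHS]/(2^-1 * boundary_prism Hc f s) -[LHS]/(avg f s - f s).
  have := h s; rewrite p0 add0r => ->.
  have -> : push idfun s = s by apply/continuousEP.
  by rewrite /avg; field.
case: p f {df h p0} => [|p] f /=; first by rewrite scaler0.
by exists (2^-1 *: prism Hc f); rewrite linearZ.
Qed.

Section Splitting.
Variables (e : AQ) (e1 : burnside_res e = 1).

Definition splitting p : {linear HQ R X p -> HG R X p} :=
  @lin_induced _ _ _ dC dB (lin_avg_section e1) (avg_section_d e1) p.

Lemma splitting_class p (f : C p) : diff f = 0 ->
  splitting p (HQclass f) = class dB (avg_section e1 f).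
Proof. exact: (@induced_class _ _ _ dC dB (lin_avg_section e1) (avg_section_d e1)). Qed.

Lemma avg_section_cocycle p (f : C p) : diff f = 0 -> dB p (avg_section e1 f) = 0.
Proof. by move=> df; rewrite [LHS]avg_section_d [dC p f]df linear0. Qed.

Lemma splittingK p : cancel (splitting p) (@Res R X p).
Proof.
move=> u; rewrite -[u]repK; have du : diff (rep u) = 0 by exact: d_rep.
by rewrite splitting_class // Res_class ?avg_section_cocycle // avg_class.
Qed.

End Splitting.
End TrivialAction.
End Bredon.

(** * The splittings of the restriction map *)

Section HomotopicallyTrivialAction.
Variables (R : realType) (X : C2space).
Local Notation dB := (@lin_bredon_diff R X).
Local Notation tau := (c2_act X).
Variable H : X * R -> X.
Hypothesis Hc : continuous H.
Hypothesis H0 : forall x, H (x, 0) = x.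
Hypothesis H1 : forall x, H (x, 1) = tau x.

Local Arguments splitting {R X e} e1 p.

Lemma HQrepK p (u : HQ R X p) : HQclass (rep u) = u.
Proof. exact: repK. Qed.

Lemma diff_rep p (u : HQ R X p) : diff (rep u) = 0.
Proof. exact: d_rep. Qed.

(** Both classes are represented by averages, whose cup product is invariant; hence it is
    its own average, and e being idempotent makes its extension to a Bredon cochain the
    product of the two extensions. *)
Lemma splitting_cup (e : AQ) (e1 : burnside_res e = 1) p q (u : HQ R X p) (v : HQ R X q) :
  e * e = e ->
  splitting e1 (p + q) (cup u v) = HGcup (splitting e1 p u) (splitting e1 q v).
Proof.
move=> ee; rewrite -[u]HQrepK -[v]HQrepK.
set f := rep u; set g := rep v.
have df : diff f = 0 by exact: diff_rep.
have dg : diff g = 0 by exact: diff_rep.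
have daf := avg_cocycle df; have dag := avg_cocycle dg.
rewrite -{1}(avg_class Hc H0 H1 df) -{1}(avg_class Hc H0 H1 dg) cup_class //.
rewrite !splitting_class // ?HGcup_class ?avg_section_cocycle //; last first.
  exact: cupc_cocycle.
have avgc s : avg (cupc (avg f) (avg g)) s = cupc (avg f) (avg g) s.
  rewrite {1}/avg /cupc /front /back -!push_subsimplex !avg_inv.
  have half (x : rat) : 2^-1 * (x + x) = x by field.
  exact: half.
congr (class _ _); apply: val_inj; congr pair; apply/funext => s; first exact: avgc.
rewrite avgc.
have scale_idem (a b : rat) : (a * b) *: e = (a *: e) * (b *: e).
  by rewrite -scalerAl -scalerAr ee scalerA.
apply: etrans (scale_idem _ _) _.
by rewrite /cupm /= !push_subsimplex.
Qed.

Lemma splitting_one :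
  splitting burnside_res1 0 (HQone R X) = HGone R X.
Proof.
rewrite /HQone splitting_class; last first.
  apply/funext => s; rewrite /diff !big_ord_recl big_ord0 /= addr0.
  by rewrite expr0 expr1 scale1r scaleN1r subrr.
rewrite -HGclass_val; congr HGclass; congr pair; apply/funext => s.
by rewrite /= /avg mulVf ?scale1r.
Qed.

Lemma splitting_act p a (u : HQ R X p) :
  splitting burnside_res_half_x p (burnside_res a *: u) =
  HGact a (splitting burnside_res_half_x p u).
Proof.
rewrite linearZ /= -[u]HQrepK splitting_class ?diff_rep //.
rewrite HGact_class ?avg_section_cocycle ?diff_rep //.
rewrite -[LHS]classZ ?avg_section_cocycle ?diff_rep //.
congr (class _ _); apply: val_inj; congr pair; apply/funext => s /=.
by rewrite -scalerAr mul_half_x scalerA mulrC -scalerA.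
Qed.

Theorem homotopic_action_splitting :
  (exists s, @algebra_splitting R X s) /\ exists s, @module_splitting R X s.
Proof.
split.
  exists (splitting burnside_res1); split.
  - exact: splittingK Hc H0 H1 _ burnside_res1.
  - exact: splitting_one.
  - by move=> p q u v; apply: splitting_cup; rewrite mul1r.
exists (splitting burnside_res_half_x); split.
  exact: splittingK Hc H0 H1 _ burnside_res_half_x.
exact: splitting_act.
Qed.

End HomotopicallyTrivialAction.

(** * The homotopy from the identity to the involution of BU(n) *)

Section Scaling.
Variable K : numFieldType.

Definition scale_poly (l : K) (p : {poly K}) : {poly K} := p \Po (l *: 'X).

Lemma coef_scale_poly l p k : (scale_poly l p)`_k = l ^+ k * p`_k.
Proof.
rewrite /scale_poly; elim/poly_ind: p k => [|p c IH] k.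
  by rewrite comp_poly0 !coef0 mulr0.
rewrite comp_poly_MXaddC -scalerAr !coefD coefZ !coefMX !coefC.
case: k => [|k] /=; first by rewrite mulr0 expr0 mul1r.
by rewrite !addr0 IH mulrA -exprS.
Qed.

Definition scale_mx N (l : K) : 'M[K]_N := diag_mx (\row_j l ^+ j).

Lemma scale_poly_rV N l (v : 'rV[K]_N) :
  scale_poly l (rVpoly v) = rVpoly (v *m scale_mx N l).
Proof.
apply/polyP => k; rewrite coef_scale_poly !coef_rVpoly.
case: insubP => [i _ <-|_]; last by rewrite mulr0.
by rewrite mul_mx_diag !mxE mulrC.
Qed.

Lemma row_free_scale n N l (A : 'M[K]_(n, N)) :
  l != 0 -> row_free A -> row_free (A *m scale_mx N l).
Proof.
move=> l0 fA; rewrite /row_free mxrankMfree // row_free_unit.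
rewrite unitmxE det_diag unitfE; apply/prodf_neq0 => j _.
by rewrite mxE expf_neq0.
Qed.

Lemma row_span_scale n N l (A : 'M[K]_(n, N)) :
  scale_poly l @` row_span A = row_span (A *m scale_mx N l).
Proof.
rewrite /row_span image_comp; apply: eq_imagel => c _ /=.
by rewrite scale_poly_rV mulmxA.
Qed.

Lemma scale_plane n l (W : Gr K n) : l != 0 -> is_plane n (scale_poly l @` W).
Proof.
move=> l0; have [N [A [fA ->]]] := planeP W; exists N, (A *m scale_mx N l).
by rewrite row_span_scale row_free_scale.
Qed.

Lemma scale_poly1 p : scale_poly 1 p = p.
Proof. by apply/polyP => k; rewrite coef_scale_poly expr1n mul1r. Qed.

Lemma scale_polyN1 p : scale_poly (-1) p = sign_poly p.
Proof. by rewrite /scale_poly scaleN1r. Qed.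

End Scaling.

Section Rotation.
Variable R : realType.

(** The path avoids 0: its real part vanishes only at t = 1/2, where its imaginary part is
    1/4. *)
Definition rotor (t : R) : R[i] := Complex (1 - 2 * t) (t * (1 - t)).

Lemma rotor_neq0 t : rotor t != 0.
Proof.
apply/eqP => -[] /eqP; rewrite subr_eq0 => /eqP t12 /eqP.
rewrite mulf_eq0 subr_eq0 => /orP[] /eqP tE; move: t12; rewrite tE.
  by rewrite mulr0 => /eqP; rewrite oner_eq0.
by rewrite -tE; lra.
Qed.

Lemma rotor0 : rotor 0 = 1.
Proof. by rewrite /rotor mulr0 subr0 mul0r. Qed.

Lemma rotor1 : rotor 1 = -1.
Proof.
rewrite /rotor subrr mulr0 mulr1; apply/eqP.
by rewrite eq_complex /= oppr0 eqxx andbT; apply/eqP; ring.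
Qed.

Lemma rotor_continuous : continuous (rotor : R -> (R[i] : numFieldType)).
Proof.
have tc : continuous (fun t : R => t) by move=> t; exact: cvg_id.
have c1 (c : R) : continuous (fun _ : R => c) by move=> t; exact: cvg_cst.
apply: continuous_Complex => t.
  exact: (continuousB (c1 _ _) (continuousM (c1 _ _) (tc t))).
exact: (continuousM (tc t) (continuousB (c1 _ _) (tc t))).
Qed.

Lemma continuous_exprn (K : numFieldType) k : continuous (fun z : K => z ^+ k).
Proof.
elim: k => [|k IH].
  have -> : (fun z : K => z ^+ 0) = (fun=> 1) by apply/funext => z; rewrite expr0.
  exact: cst_continuous.
have -> : (fun z : K => z ^+ k.+1) = (fun z => z * z ^+ k).
  by apply/funext => w; rewrite exprS.
by move=> z; exact: (@continuousM K K id (fun z => z ^+ k) z (@cvg_id _ _) (IH z)).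
Qed.

Variable n : nat.
Local Notation G := (Gr R[i] n).

Definition rotate (x : G * R) : G := Plane (scale_plane x.1 (rotor_neq0 x.2)).

Lemma rotate0 W : rotate (W, 0) = W.
Proof.
apply: Gr_inj; rewrite /= rotor0 -[RHS]image_id.
by apply: eq_imagel => p _; rewrite scale_poly1.
Qed.

Lemma rotate1 W : rotate (W, 1) = Gr_act W.
Proof.
apply: Gr_inj; rewrite /= rotor1.
by apply: eq_imagel => p _; rewrite scale_polyN1.
Qed.

Definition rotate_frame N (x : frame R[i] n N * R) : frame R[i] n N :=
  @exist _ (fun B => B \in [set A : 'M[R[i]]_(n, N) | row_free A])
    (val x.1 *m scale_mx N (rotor x.2))
    (mem_set (row_free_scale (rotor_neq0 x.2) (set_valP x.1))).

Lemma rotate_frameE N (A : frame R[i] n N) t :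
  frame_span (rotate_frame (A, t)) = rotate (frame_span A, t).
Proof. by apply: Gr_inj; rewrite /= row_span_scale. Qed.

Lemma rotate_frame_continuous N : continuous (@rotate_frame N).
Proof.
apply: continuous_to_set_type; apply: continuous_mx => i j /=.
under [X in continuous X]funext do rewrite mul_mx_diag !mxE.
move=> -[A t] /=.
apply: (@cvgM _ _ _ _ (fun x : frame R[i] n N * R => val x.1 i j)
  (fun x => rotor x.2 ^+ j)).
  apply: (@cvg_comp _ _ _ fst (fun A : frame R[i] n N => val A i j)); first exact: cvg_fst.
  exact: continuous_coord_val.
apply: (@cvg_comp _ _ _ snd (fun t => rotor t ^+ j)); first exact: cvg_snd.
apply: (@cvg_comp _ _ _ rotor (fun z => z ^+ j)); first exact: rotor_continuous.
exact: continuous_exprn.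
Qed.

(** For an open U and a compact neighbourhood J of t with rotate (W, J) in U, the set V0 of
    all W' with rotate (W', J) in U is open: this can be tested on frames, where
    rotate_frame is jointly continuous and the tube lemma applies. *)
Lemma rotate_continuous : continuous rotate.
Proof.
have rotate_frame_open N (A : frame R[i] n N) (t : R) (U : set G) :
    open U -> U (rotate (frame_span A, t)) ->
    \forall B \near A & s \near t, U (rotate (frame_span B, s)).
  move=> oU; rewrite -rotate_frameE => UA.
  have : nbhs (rotate_frame (A, t)) (@frame_span R[i] n N @^-1` U).
    by apply: open_nbhs_nbhs; split=> //; exact: oU.
  move=> /rotate_frame_continuous [PQ PQ_nbhs PQU]; exists PQ => // -[B s] /PQU /=.
  by rewrite rotate_frameE.
move=> [W t]; have [N [A [fA WA]]] := planeP W.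
pose A' : frame R[i] n N :=
  @exist _ (fun B => B \in [set A : 'M[R[i]]_(n, N) | row_free A]) A (mem_set fA).
have {WA} -> : W = frame_span A' by exact: Gr_inj.
move=> V; rewrite nbhsE => -[U [oU UW] UV].
apply: (@filterS _ _ _ (rotate @^-1` U)) => [x /UV //|].
have [[P Q] [/= PA Qt] PQ] := rotate_frame_open _ _ _ _ oU UW.
have [e /= e0 eQ] : exists2 e : R, 0 < e & `[t - e, t + e]%classic `<=` Q.
  move/nbhs_ballP : Qt => [e /= e0 eQ]; exists (e / 2); first by rewrite divr_gt0.
  move=> s /=; rewrite in_itv /= -ler_distlC => ts; apply: eQ.
  by rewrite /ball /=; apply: le_lt_trans ts _; lra.
set J := `[t - e, t + e]%classic in eQ.
have Jt : nbhs t J.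
  apply/nbhs_ballP; exists e => //= s; rewrite /ball /= /J /= in_itv /= -ler_distlC.
  exact: ltW.
pose V0 := [set W : G | forall s, J s -> U (rotate (W, s))].
have oV0 : open V0.
  rewrite Gr_openE => M; rewrite openE => B VB.
  have /compact_near_coveringP tube := @segment_compact R (t - e) (t + e).
  apply: (tube _ (nbhs B) (fun B s => U (rotate (frame_span B, s)))) => s Js.
  have [[P' Q'] [/= P'B Q's] PQ'] := rotate_frame_open _ _ _ _ oU (VB s Js).
  by exists (Q', P') => //= -[s' B'] /= [Q's' P'B']; exact: (PQ' (B', s')).
exists (V0, J); last by move=> [W' s] /= [VW' Js]; exact: VW'.
split=> //=; apply: open_nbhs_nbhs; split=> // s Js.
by apply: (PQ (A', s)); split; [exact: nbhs_singleton | exact: eQ].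
Qed.

End Rotation.

Theorem proposition4p1 (R : realType) (n : nat) (hn : (1 <= n)%N) :
  [/\ (forall p (u : HQ R (BU R n) p), exists z : HG R (B_GU R n) p, Res z = u),
      (exists s : forall p, {linear HQ R (BU R n) p -> HG R (B_GU R n) p},
        algebra_splitting s),
      (exists s : forall p, {linear HQ R (BU R n) p -> HG R (B_GU R n) p},
        module_splitting s) &
      (forall c : forall m i, HQ R (BU R m) i.*2, is_chern c ->
        forall i, (1 <= i <= n)%N ->
          exists z : HG R (B_GU R n) i.*2, Res z = c n i)].
Proof.
have [alg mod_] := @homotopic_action_splitting R (B_GU R n) _
  (@rotate_continuous R n) (@rotate0 R n) (@rotate1 R n).
have onto p (u : HQ R (BU R n) p) : exists z : HG R (B_GU R n) p, Res z = u.
  by have [s [sK _ _]] := alg; exists (s p u); exact: sK.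
by split=> // c _ i _; exact: onto.
Qed.
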